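(* Let $\cong$ be a congruence on LTSs such that $L\doteq L'$ implies $L\cong L'$, $\cong$ preserves $\Sigma$ but does not preserve $\mathit{Tr}$, and $D\cong V$. Then $\cong$ is the equivalence induced by $\Sigma$, i.e. $L\cong L'$ iff $\Sigma(L)=\Sigma(L')$.
   Context: An LTS is a tuple $L=(S,\Sigma,\Delta,\hat s)$ with states $S$, alphabet $\Sigma$ (possibly infinite), $\tau\notin\Sigma$ a reserved invisible action, transitions $\Delta\subseteq S\times(\Sigma\cup\{\tau\})\times S$, initial state $\hat s$; $\Sigma(L)$ denotes the alphabet. Operators: action prefix $a.L$ ($a\neq\tau$): new initial state $\hat s'$, alphabet $\Sigma\cup\{a\}$, transitions $\Delta\cup\{(\hat s',a,\hat s)\}$. Hiding $L\setminus A$: alphabet $\Sigma\setminus A$, each transition labelled by an element of $A$ relabelled $\tau$, otherwise unchanged. Relational renaming $L\Phi$ ($\Phi$ a set of pairs, $\tau$ not in its domain $\mathcal D(\Phi)$ or range; $\Phi(a,b)$ means $(a,b)\in\Phi$ or $a=b\notin\mathcal D(\Phi)$): alphabet $\{b\mid\exists a\in\Sigma:\Phi(a,b)\}$, transitions $\{(s,b,s')\mid\exists a:(s,a,s')\in\Delta\wedge\Phi(a,b)\}$, same states and initial state. Parallel composition $L_1\|L_2$: states $S_1\times S_2$, alphabet $\Sigma_1\cup\Sigma_2$, initial $(\hat s_1,\hat s_2)$; actions in $\Sigma_1\cap\Sigma_2$ are taken jointly by both components, all other actions (including $\tau$) by one component while the other stays put. A congruence is an equivalence $\cong$ with $L\cong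 L'\Rightarrow a.L\cong a.L',\ L\setminus A\cong L'\setminus A,\ L\Phi\cong L'\Phi,\ L\|L''\cong L'\|L'',\ L''\|L\cong L''\|L'$. For $\sigma=a_1\cdots a_n\in\Sigma^*$, $s\stackrel{\sigma}{\Rightarrow}s'$ means a finite path from $s$ to $s'$ whose non-$\tau$ labels are exactly $a_1,\dots,a_n$ in order; $\hat s\stackrel{\xi}{\Rightarrow}$ for $\xi\in\Sigma^\omega$ means an infinite path from $\hat s$ whose non-$\tau$ label sequence is $\xi$; $s\stackrel{\tau^\omega}{\to}$ means an infinite path of $\tau$-transitions from $s$. Define $\mathit{Tr}(L)=\{\sigma\in\Sigma^*\mid\exists s:\hat s\stackrel\sigma\Rightarrow s\}$, $\mathit{Div}(L)=\{\sigma\in\Sigma^*\mid\exists s:\hat s\stackrel\sigma\Rightarrow s\wedge s\stackrel{\tau^\omega}\to\}$, $\mathit{Inf}(L)=\{\xi\in\Sigma^\omega\mid\hat s\stackrel\xi\Rightarrow\}$, $\mathit{Sf}(L)=\{(\sigma,A)\in\Sigma^*\times2^\Sigma\mid\exists s:\hat s\stackrel\sigma\Rightarrow s\wedge\forall a\in A\cup\{\tau\}\,\forall s':(s,a,s')\notin\Delta\}$. $L\doteq L'$ (CFFD-equivalence) iff $\Sigma,\mathit{Sf},\mathit{Div},\mathit{Inf}$ all agree on $L$ and $L'$. An equivalence preserves $X$ if $L\cong L'\Rightarrow X(L)=X(L')$; the equivalence induced by $\Sigma,X_1,\dots,X_k$ relates $L,L'$ iff all these functions agree on them. $D$ is the one-state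 LTS with empty alphabet and no transitions; $V$ is the one-state LTS with empty alphabet and a single $\tau$ self-loop. *)

(* Defs.v *)
From mathcomp Require Import all_boot.
From mathcomp Require Import boolp classical_sets functions cardinality.

Set Implicit Arguments.
Unset Strict Implicit.
Unset Printing Implicit Defensive.

Local Open Scope classical_set_scope.

(* [Act] is the universe of visible action names; alphabets are arbitrary
   subsets of it. A transition label is an [option Act]: [None] is the
   invisible action tau, [Some a] the visible action [a]. *)
Record LTS (Act : Type) := MkLTS {
  state : Type;
  alph : set Act;
  trans : state -> option Act -> state -> Prop;
  init : state;
  trans_alph : forall s a s', trans s (Some a) s' -> alph a
}.

Section Operators.
Context {Act : Type}.
Implicit Types (L : LTS Act) (a b : Act) (l : option Act).

(* The fresh initial state is [None : option (state L)]. *)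
Definition prefix_trans a L (s : option (state L)) l (s' : option (state L)) :
    Prop :=
  match s, s' with
  | None, Some t' => l = Some a /\ t' = init L
  | Some t, Some t' => trans t l t'
  | _, None => False
  end.

Lemma prefix_trans_alph a L s b s' :
  @prefix_trans a L s (Some b) s' -> (alph L `|` [set a]) b.
Proof.
case: s s' => [t|] [t'|] //=; first by move=> h; left; exact: trans_alph h.
by case=> -[->] _; right.
Qed.

Definition lts_prefix a L : LTS Act :=
  @MkLTS Act (option (state L)) (alph L `|` [set a]) (@prefix_trans a L) None
    (@prefix_trans_alph a L).

Definition hide_trans L (A : set Act) (s : state L) l (s' : state L) : Prop :=
  match l with
  | None => trans s None s' \/ (exists2 a, A a & trans s (Some a) s')
  | Some a => trans s (Some a) s' /\ ~ A a
  end.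

Lemma hide_trans_alph L A s b s' :
  @hide_trans L A s (Some b) s' -> (alph L `\` A) b.
Proof. by case=> h nA; split=> //; exact: trans_alph h. Qed.

Definition lts_hide L (A : set Act) : LTS Act :=
  @MkLTS Act (state L) (alph L `\` A) (@hide_trans L A) (init L)
    (@hide_trans_alph L A).

Definition renames (Phi : set (Act * Act)) a b : Prop :=
  Phi (a, b) \/ (a = b /\ ~ fst_set Phi a).

Definition rename_alph L Phi : set Act :=
  [set b | exists2 a, alph L a & renames Phi a b].

(* tau is outside the domain and range of [Phi], so it is renamed only to
   itself. *)
Definition rename_trans L Phi (s : state L) l (s' : state L) : Prop :=
  match l with
  | None => trans s None s'
  | Some b => exists2 a, trans s (Some a) s' & renames Phi a b
  end.

Lemma rename_trans_alph L Phi s b s' :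
  @rename_trans L Phi s (Some b) s' -> rename_alph L Phi b.
Proof. by case=> a h ab; exists a => //; exact: trans_alph h. Qed.

Definition lts_rename L (Phi : set (Act * Act)) : LTS Act :=
  @MkLTS Act (state L) (rename_alph L Phi) (@rename_trans L Phi) (init L)
    (@rename_trans_alph L Phi).

Definition common (A B : set Act) l : Prop :=
  match l with None => False | Some a => (A `&` B) a end.

Definition par_trans L1 L2 (s : state L1 * state L2) l
    (s' : state L1 * state L2) : Prop :=
  (common (alph L1) (alph L2) l /\ trans s.1 l s'.1 /\ trans s.2 l s'.2) \/
  (~ common (alph L1) (alph L2) l /\
    ((trans s.1 l s'.1 /\ s'.2 = s.2) \/ (s'.1 = s.1 /\ trans s.2 l s'.2))).

Lemma par_trans_alph L1 L2 s b s' :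
  @par_trans L1 L2 s (Some b) s' -> (alph L1 `|` alph L2) b.
Proof.
case=> [[_ [h _]]|[_ [[h _]|[_ h]]]].
- by left; exact: trans_alph h.
- by left; exact: trans_alph h.
- by right; exact: trans_alph h.
Qed.

Definition lts_par L1 L2 : LTS Act :=
  @MkLTS Act (state L1 * state L2)%type (alph L1 `|` alph L2)
    (@par_trans L1 L2) (init L1, init L2) (@par_trans_alph L1 L2).

Lemma D_trans_alph (s : unit) a (s' : unit) : False -> (@set0 Act) a.
Proof. by []. Qed.

Definition lts_D : LTS Act :=
  @MkLTS Act unit set0 (fun _ _ _ => False) tt D_trans_alph.

Lemma V_trans_alph (s : unit) a (s' : unit) : Some a = None -> (@set0 Act) a.
Proof. by []. Qed.

Definition lts_V : LTS Act :=
  @MkLTS Act unit set0 (fun _ l _ => l = None) tt V_trans_alph.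

End Operators.

Section Semantics.
Context {Act : Type}.
Implicit Types (L : LTS Act).

Inductive path L : state L -> seq (option Act) -> state L -> Prop :=
| path_nil s : path s [::] s
| path_cons s l s' ls s'' :
    trans s l s' -> path s' ls s'' -> path s (l :: ls) s''.

Definition visible (ls : seq (option Act)) : seq Act := pmap id ls.

Definition weak L (s : state L) (sigma : seq Act) (s' : state L) : Prop :=
  exists2 ls, path s ls s' & visible ls = sigma.

Definition diverges L (s : state L) : Prop :=
  exists2 st : nat -> state L,
    st 0 = s & forall i, trans (st i) None (st i.+1).

(* [p n] is the position of the [n]-th visible label of the infinite label
   sequence [lab]. *)
Definition visible_inf (lab : nat -> option Act) (xi : nat -> Act) : Prop :=
  exists p : nat -> nat,
    [/\ {homo p : m n / (m < n)%N},
        forall n, lab (p n) = Some (xi n) &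
        forall i, lab i <> None -> exists n, i = p n].

Definition weak_inf L (s : state L) (xi : nat -> Act) : Prop :=
  exists (st : nat -> state L) (lab : nat -> option Act),
    [/\ st 0 = s, forall i, trans (st i) (lab i) (st i.+1) &
        visible_inf lab xi].

(* By [trans_alph], the sequences in the following sets are automatically
   sequences over [alph L]. *)
Definition Tr L : set (seq Act) :=
  [set sigma | exists s, weak (init L) sigma s].

Definition Div L : set (seq Act) :=
  [set sigma | exists2 s, weak (init L) sigma s & diverges s].

Definition Inf L : set (nat -> Act) :=
  [set xi | weak_inf (init L) xi].

Definition refuses L (s : state L) (A : set Act) : Prop :=
  (forall s', ~ trans s None s') /\
  (forall a, A a -> forall s', ~ trans s (Some a) s').

Definition Sf L : set (seq Act * set Act) :=
  [set x | x.2 `<=` alph L /\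
    exists2 s, weak (init L) x.1 s & refuses s x.2].

Definition CFFD_equiv L L' : Prop :=
  [/\ alph L = alph L', Sf L = Sf L', Div L = Div L' & Inf L = Inf L'].

Record congruence (R : LTS Act -> LTS Act -> Prop) : Prop := {
  cong_equivalence : RelationClasses.Equivalence R;
  cong_prefix : forall a L L', R L L' -> R (lts_prefix a L) (lts_prefix a L');
  cong_hide : forall A L L', R L L' -> R (lts_hide L A) (lts_hide L' A);
  cong_rename : forall Phi L L',
    R L L' -> R (lts_rename L Phi) (lts_rename L' Phi);
  cong_parl : forall L'' L L', R L L' -> R (lts_par L L'') (lts_par L' L'');
  cong_parr : forall L'' L L', R L L' -> R (lts_par L'' L) (lts_par L'' L')
}.

Definition preserves (R : LTS Act -> LTS Act -> Prop) (X : Type)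
    (f : LTS Act -> X) : Prop :=
  forall L L', R L L' -> f L = f L'.

End Semantics.

(* Main.v *)
(* Since D and V are related, so are L ~ L || D and L || V, where L || V adds a
   tau-loop to every state of L; hence only the alphabet, the traces and the
   infinite traces can matter. Let L1 and L2 be related, with a trace sigma of
   L1 missing from L2. After an injective renaming some b is outside their
   alphabet. Put them in parallel with a tester that reads sigma and then loops
   on b, hide everything but b, and rename b to all actions: L1 turns into the
   process that can run every action forever, L2 into the one that can do
   nothing visible. So these are related, over every alphabet. Composing them
   with an arbitrary L relates L to the process with the alphabet of L that does
   nothing. *)
Require Import Defs.
From mathcomp Require Import all_boot.
From mathcomp Require Import boolp classical_sets functions cardinality.

Set Implicit Arguments.
Unset Strict Implicit.
Unset Printing Implicit Defensive.

Local Open Scope classical_set_scope.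

(** * Weak paths and strong simulations *)

Section Simulation.
Context {Act : Type}.
Implicit Types (L M : LTS Act).

Lemma weak_cons M (s t u : state M) l sigma :
  trans s l t -> weak t sigma u -> weak s (visible [:: l] ++ sigma) u.
Proof.
move=> slt [ls tu <-]; exists (l :: ls); first exact: path_cons slt tu.
by case: l {slt}.
Qed.

Lemma weak_rcons M (s t u : state M) l sigma :
  weak s sigma t -> trans t l u -> weak s (sigma ++ visible [:: l]) u.
Proof.
move=> [ls st <-] tlu; elim: st tlu => {s t ls} [s|s k s' ls t sks' _ IH] tu.
  rewrite -[_ ++ _]cats0; apply: (weak_cons tu).
  by exists [::] => //; exact: path_nil.
by have := weak_cons sks' (IH tu); case: k {sks'}.
Qed.

(** Allows induction on [weak] towards a fixed end state, with label sequences already reduced to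
    their visible part. *)
Lemma weak_ind M (P : state M -> seq Act -> Prop) (u : state M) :
    P u [::] ->
    (forall s l t sigma, trans s l t -> P t sigma ->
       P s (visible [:: l] ++ sigma)) ->
  forall s sigma, weak s sigma u -> P s sigma.
Proof.
move=> P0 PS s _ [ls su <-]; elim: su P0 => // {}s l t {}ls v slt _ IH P0.
by have := PS _ _ _ _ slt (IH P0); case: l {slt}.
Qed.

Definition simulation M M' (S : state M -> state M' -> Prop) : Prop :=
  forall s s' l t, S s s' -> trans s l t -> exists2 t', trans s' l t' & S t t'.

Section StrongSimulation.
Context {M M' : LTS Act} {S : state M -> state M' -> Prop}.
Hypothesis simS : simulation S.

Lemma sim_weak s s' sigma t :
  S s s' -> weak s sigma t -> exists2 t', weak s' sigma t' & S t t'.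
Proof.
move=> Sss' w.
elim/weak_ind: s sigma / w s' Sss' => [|s l u sigma slu IH] s' S1.
  by exists s' => //; exists [::] => //; exact: path_nil.
have [u' su' /IH[t' ut' S2]] := simS S1 slu.
by exists t' => //; exact: weak_cons su' ut'.
Qed.

(** Dependent choice: each chosen state carries the proof that it is related to [st i], so the next
    choice is always possible. *)
Lemma sim_run s' (st : nat -> state M) lab :
    S (st 0) s' -> (forall i, trans (st i) (lab i) (st i.+1)) ->
  exists2 st' : nat -> state M',
    st' 0 = s' & forall i, trans (st' i) (lab i) (st' i.+1).
Proof.
move=> S0 run.
have next i (x : {x | S (st i) x}) :
    {y : {y | S (st i.+1) y} | trans (sval x) (lab i) (sval y)}.
  case: x => x Sx; have [y xy Sy] := cid2 (simS Sx (run i)).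
  by exists (exist _ y Sy).
pose f := fix f i : {x | S (st i) x} :=
  if i is j.+1 then sval (next j (f j)) else exist _ s' S0.
by exists (fun i => sval (f i)) => // i; exact: (svalP (next i (f i))).
Qed.

Lemma sim_diverges s s' : S s s' -> diverges s -> diverges s'.
Proof.
move=> Sss' [st st0 run].
by rewrite -st0 in Sss'; have [st' ? ?] := sim_run Sss' run; exists st'.
Qed.

Lemma sim_weak_inf s s' xi : S s s' -> weak_inf s xi -> weak_inf s' xi.
Proof.
move=> Sss' [st [lab [st0 run vis]]].
by rewrite -st0 in Sss'; have [st' ? ?] := sim_run Sss' run; exists st', lab.
Qed.

End StrongSimulation.

Lemma weak_cat M (s t u : state M) sigma rho :
  weak s sigma t -> weak t rho u -> weak s (sigma ++ rho) u.
Proof.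
move=> w wu; elim/weak_ind: s sigma / w => // s l v sigma slv IH.
by rewrite -catA; exact: weak_cons slv IH.
Qed.

Lemma weak_inf_tau M (s t : state M) xi :
  weak s [::] t -> weak_inf t xi -> weak_inf s xi.
Proof.
move=> w tx; suff gen sigma : weak s sigma t -> sigma = [::] -> weak_inf s xi.
  exact: gen w erefl.
move=> {}w; elim/weak_ind: s sigma / w => // {}s [a|] u sigma su IH //= /IH.
move=> [st [lab [st0 run [p [p_mono p_lab p_surj]]]]].
(* One tau-step is put in front, so every visible position moves from [p n] to its successor. *)
exists (fun i => if i is j.+1 then st j else s).
exists (fun i => if i is j.+1 then lab j else None); split=> [//| |].
  by move=> [|i] /=; [rewrite st0|exact: run].
exists (fun n => (p n).+1); split=> [m n /p_mono //|//|[//|i] /p_surj[n ->]].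
by exists n.
Qed.

Lemma iso_CFFD M M' (h : state M -> state M') (g : state M' -> state M) :
    alph M = alph M' -> cancel h g -> cancel g h -> h (init M) = init M' ->
    (forall s l t, trans s l t <-> trans (h s) l (h t)) ->
  CFFD_equiv M M'.
Proof.
move=> eqA hK gK h0 hT.
have g0 : g (init M') = init M by rewrite -h0 hK.
have simh : simulation (fun s s' => s' = h s).
  by move=> s s1 l t -> slt; exists (h t) => //; apply/hT.
have simg : simulation (fun s' s => s = g s').
  by move=> s s1 l t -> slt; exists (g t) => //; apply/hT; rewrite !gK.
split=> //; apply/seteqP; split.
- move=> [sigma A] [/= sA [s ws [noTau noA]]].
  split=> /=; first by rewrite -eqA.
  have [s' ws' ?] := sim_weak simh (esym h0) ws; subst s'; exists (h s) => //.
  (* Each target [t] is [h (g t)], so a step of [h s] would reflect to a step that [s] refuses. *)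
  by split=> [t|a Aa t]; rewrite -(gK t) -hT; [exact: noTau|exact: noA].
- move=> [sigma A] [/= sA [s ws [noTau noA]]]; split=> /=; first by rewrite eqA.
  have [s' ws' ?] := sim_weak simg (esym g0) ws; subst s'; exists (g s) => //.
  by split=> [t|a Aa t]; rewrite hT gK; [exact: noTau|exact: noA].
- move=> sigma [s ws ds].
  have [s' ws' ?] := sim_weak simh (esym h0) ws; subst s'.
  by exists (h s) => //; exact: (sim_diverges simh) ds.
- move=> sigma [s ws ds].
  have [s' ws' ?] := sim_weak simg (esym g0) ws; subst s'.
  by exists (g s) => //; exact: (sim_diverges simg) ds.
- by move=> xi; apply: (sim_weak_inf simh); rewrite ?h0 ?g0.
- by move=> xi; apply: (sim_weak_inf simg); rewrite ?h0 ?g0.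
Qed.

(** * Composition with [D] and with [V] *)

Lemma par_D_equiv L : CFFD_equiv (lts_par L lts_D) L.
Proof.
apply: (@iso_CFFD (lts_par L lts_D) L fst (fun s => (s, tt))) => //=.
- exact: setU0.
- by case=> s [].
- move=> s l t; split=> [[[_ []]//|[_ [[]|[_ []]]]//]|slt]; right; split.
    by case: l {slt} => // a [].
  by left; case: s.2 t.2 => -[].
Qed.

Lemma par_V_trans L (s t : state L * unit) l :
  @trans _ (lts_par L lts_V) s l t <->
  trans s.1 l t.1 \/ (l = None /\ t.1 = s.1).
Proof.
have nc : ~ common (alph L) (alph (@lts_V Act)) l by case: l => // a [].
split=> [[[]//|[_ [[]|[]]]]|H]; [by left|by right|right; split=> //].
by case: H => [?|[? ?]]; [left; split=> //; case: s.2 t.2 => -[]|right].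
Qed.

(* A tau-step may be matched by no step at all, because [L' || V] has a tau-loop
   at every state. *)
Definition simulated L L' : Prop :=
  exists (S : state L -> state L' -> Prop) s0,
    [/\ weak (init L') [::] s0, S (init L) s0 &
        forall s s' l t, S s s' -> trans s l t ->
          exists2 t', trans s' l t' \/ (l = None /\ t' = s') & S t t'].

(** The loop of [V] turns standing still into a genuine tau-step, so [S] lifts to a strong
    simulation starting at [s0], which is reached silently. *)
Lemma simulated_par_V L L' : simulated L L' ->
  Div (lts_par L lts_V) `<=` Div (lts_par L' lts_V) /\
  Inf (lts_par L lts_V) `<=` Inf (lts_par L' lts_V).
Proof.
move=> [S [s0 [w0 S0 simS]]].
pose SV (s : state (lts_par L lts_V)) (s' : state (lts_par L' lts_V)) :=
  S s.1 s'.1.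
have simSV : simulation SV.
  move=> s s' l t Sss' /par_V_trans[slt|[-> ts]].
    have [t' s't' Stt'] := simS _ _ _ _ Sss' slt.
    by exists (t', tt) => //; exact/par_V_trans.
  by exists s'; [apply/par_V_trans; right|rewrite /SV ts].
have simL' : simulation (M' := lts_par L' lts_V) (fun s s' => s = s'.1).
  by move=> s s1 l t -> slt; exists (t, tt) => //; apply/par_V_trans; left.
have {}w0 : weak (init (lts_par L' lts_V)) [::] (s0, tt).
  have init_L' : init L' = (init (lts_par L' lts_V)).1 by [].
  by have [[s1 []] ? ->] := sim_weak simL' init_L' w0.
have {}S0 : SV (init (lts_par L lts_V)) (s0, tt) := S0.
split=> [sigma [s ws _]|xi].
  have [s' ws' _] := sim_weak simSV S0 ws.
  exists s'; first exact: weak_cat w0 ws'.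
  (* Every state diverges by looping, so membership in [Div] only asks for a trace. *)
  by exists (fun=> s') => // i; apply/par_V_trans; right.
by move/(sim_weak_inf simSV S0)/(weak_inf_tau w0).
Qed.

Lemma Sf_par_V L : Sf (lts_par L lts_V) = set0.
Proof.
apply/seteqP; split=> // x [_ [s _ [noTau _]]].
by case: (noTau s); apply/par_V_trans; right.
Qed.

End Simulation.

(** * Running, stopped and testing processes *)

Section Probe.
Context {Act : Type}.
Implicit Types (L M : LTS Act) (A B : set Act) (a b : Act).

Definition run_trans A (s : unit) (l : option Act) (s' : unit) : Prop :=
  if l is Some a then A a else False.

Lemma run_trans_alph A s a s' : run_trans A s (Some a) s' -> A a.
Proof. by []. Qed.

Definition lts_run A : LTS Act := MkLTS tt (@run_trans_alph A).

Lemma stop_trans_alph A (s : unit) a (s' : unit) : False -> A a.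
Proof. by []. Qed.

Definition lts_stop A : LTS Act :=
  @MkLTS Act unit A (fun _ _ _ => False) tt (@stop_trans_alph A).

Lemma simulated_run L : simulated L (lts_run (alph L)).
Proof.
exists (fun _ _ => True), tt; split=> // [|s [] [a|] t _ slt].
- by exists [::] => //; exact: path_nil.
- by exists tt => //; left; exact: trans_alph slt.
- by exists tt => //; right.
Qed.

Lemma stop_simulated A L : simulated (lts_stop A) L.
Proof.
exists (fun _ _ => True), (init L); split=> //.
by exists [::] => //; exact: path_nil.
Qed.

(** The running component is ready for every action of [L] and never moves alone, so it does not
    constrain [L]. *)
Lemma par_run_simulated L : simulated (lts_par L (lts_run (alph L))) L.
Proof.
exists (fun s s' => s' = s.1), (init L); split=> // [|s s' l t ->].
  by exists [::] => //; exact: path_nil.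
case=> [[_ [slt _]]|[nc [[slt _]|[_]]]].
- by exists t.1 => //; left.
- by exists t.1 => //; left.
- by case: l nc => [a|//] nc Aa; case: nc; split.
Qed.

Lemma simulated_par_run L : simulated L (lts_par L (lts_run (alph L))).
Proof.
exists (fun s s' => s = s'.1), (init L, tt); split=> // [|s s' l t -> slt].
  by exists [::] => //; exact: path_nil.
exists (t, tt) => //; left; case: l slt => [a|] slt; last first.
  by right; split=> //; left; split=> //; case: s'.2.
by have Aa := trans_alph slt; left.
Qed.

(** Every visible action of [L] would need the stopped component; only tau-steps survive, and they
    are matched by standing still. *)
Lemma par_stop_simulated L :
  simulated (lts_par L (lts_stop (alph L))) (lts_stop (alph L)).
Proof.
exists (fun _ _ => True), tt; split=> // [|s s' [a|] t _ H].
- by exists [::] => //; exact: path_nil.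
- case: H => [[_ []//]|[nc [[slt _]|[_ []]]]].
  by case: nc; have Aa := trans_alph slt; split.
- by exists s' => //; right.
Qed.

(* The state is the word still to be read. *)
Definition tester_trans A b (r : seq Act) (l : option Act) (r' : seq Act) :
    Prop :=
  if r is a :: r0 then [/\ l = Some a, A a & r' = r0]
  else l = Some b /\ r' = [::].

Lemma tester_trans_alph A b r a r' :
  tester_trans A b r (Some a) r' -> (A `|` [set b]) a.
Proof.
by case: r => [[[->]]|c r [[->]]]; [right|left].
Qed.

Definition lts_tester A b (sigma : seq Act) : LTS Act :=
  MkLTS sigma (@tester_trans_alph A b).

(** The tester shares all of [alph M], so it forces [M] to read [sigma], and this reading is hidden.
    The full relation [setT] then sends [b] to every action, and the last hiding trims the alphabet
    to [B]. *)
Definition probe b sigma B M : LTS Act :=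
  lts_hide
    (lts_rename
       (lts_hide (lts_par M (lts_tester (alph M) b sigma)) (alph M)) setT)
    (~` B).

(** * Behaviour of the probe *)

Section ProbeTransitions.
Variables (M : LTS Act) (b : Act) (sigma : seq Act) (B : set Act).
Hypothesis fresh_b : ~ alph M b.
Let C := probe b sigma B M.

Lemma probe_alph : alph C = B.
Proof.
apply/seteqP; split=> [a [_ /contrapT//]|a Ba]; split; last by apply.
by exists b; [split=> //; right; right|left].
Qed.

Lemma probe_tau s s' r : trans s None s' -> @trans _ C (s, r) None (s', r).
Proof. by move=> ss'; left; left; right; split=> //; left. Qed.

Lemma probe_read s a s' r :
  trans s (Some a) s' -> @trans _ C (s, a :: r) None (s', r).
Proof.
move=> ss'; have Aa := trans_alph ss'; left; right; exists a => //.
by left; split=> //; split=> //; left.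
Qed.

Lemma probe_loop s x : B x -> @trans _ C (s, [::]) (Some x) (s, [::]).
Proof.
move=> Bx; split; last by apply.
exists b; last by left.
by split=> //; right; split; [case|right].
Qed.

(** As long as a letter remains, the tester offers only that letter, which lies in [alph M] and is
    hidden; the renaming then meets no visible label. *)
Lemma probe_trans_nonnil s r l s' r' :
    r <> [::] -> @trans _ C (s, r) l (s', r') ->
  l = None /\ ((trans s None s' /\ r' = r) \/
               exists2 a, r = a :: r' & trans s (Some a) s').
Proof.
move=> r_nnil.
have vis y : ~ @trans _ (lts_hide (lts_par M (lts_tester (alph M) b sigma))
    (alph M)) (s, r) (Some y) (s', r').
  case: r r_nnil => // c r _ [[[[Ay _] _]|[nc [[ss' _]|[_ /= [[->] //]]]]] nAy].
  - exact: nAy.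
  - by apply: nAy; exact: trans_alph ss'.
have tau : @trans _ (lts_hide (lts_par M (lts_tester (alph M) b sigma))
    (alph M)) (s, r) None (s', r') -> ((trans s None s' /\ r' = r) \/
               exists2 a, r = a :: r' & trans s (Some a) s').
  case: r r_nnil {vis} => // c r _ [[[[] _]|[_ [[]|[_ []]]]]//|[a Aa]].
    by left.
  case=> [[_ [/= ss' [[<-] _ ->]]]|[nc _]]; first by right; exists a.
  by case: nc; split=> //; left.
by case: l => [x [[y /vis]]//|[/tau|[x _ [y /vis]]]//].
Qed.

Lemma probe_reads s rho s' :
  weak s rho s' -> weak (L := C) (s, rho) [::] (s', [::]).
Proof.
move: s rho; apply: weak_ind => [|s [a|] t rho st IH].
- by exists [::] => //; exact: path_nil.
- exact: weak_cons (probe_read _ st) IH.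
- exact: weak_cons (probe_tau _ st) IH.
Qed.

(** The silent initial path is the hidden reading of [sigma]; it ends where all actions of [B]
    loop. *)
Lemma run_simulated_probe : Tr M sigma -> simulated (lts_run B) C.
Proof.
move=> [s ws]; exists (fun _ s' => s' = (s, [::])), (s, [::]); split=> //.
  exact: probe_reads ws.
move=> u s' [x|//] v -> Bx; exists (s, [::]) => //; left.
exact: probe_loop Bx.
Qed.

(** Invariant: the word read by [M] followed by the remaining word is [sigma]. An empty remainder
    would make [sigma] a trace, so the visible loop is never reached. *)
Lemma probe_simulated_stop : ~ Tr M sigma -> simulated C (lts_stop B).
Proof.
move=> nTr.
exists (fun s _ => exists2 rho, weak (init M) rho s.1 & rho ++ s.2 = sigma), tt.
split=> [||[s r] s' l [t r'] /= [rho ws Erho]].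
- by exists [::] => //; exact: path_nil.
- by exists [::] => //; exists [::] => //; exact: path_nil.
have r_nnil : r <> [::].
  by move=> r0; apply: nTr; exists s; rewrite -Erho r0 cats0.
move=> /(probe_trans_nonnil r_nnil)[-> H]; exists s'; first by right.
case: H => [[st ->]|[a Er st]].
  by exists rho => //; rewrite -[rho]cats0; exact: weak_rcons ws st.
by exists (rho ++ [:: a]); [exact: weak_rcons ws st|rewrite -catA -Erho Er].
Qed.

End ProbeTransitions.

(** By injectivity a renamed label determines the original one, so renamed traces pull back. *)
Lemma Tr_rename_inj M (f : Act -> Act) sigma : injective f ->
  Tr (lts_rename M [set x | x.2 = f x.1]) (map f sigma) <-> Tr M sigma.
Proof.
move=> f_inj; have renE a c : renames [set x | x.2 = f x.1] a c <-> c = f a.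
  by split=> [[//|[_ []]]|->]; [exists (f a)|left].
split=> -[s ws]; exists s.
  have back : forall s0 rho,
      weak (L := lts_rename M [set x | x.2 = f x.1]) s0 rho s ->
      forall sigma, map f sigma = rho -> weak (L := M) s0 sigma s.
    apply: weak_ind => [[]//= _|s0 [c|] t rho st IH tau E].
    - by exists [::] => //; exact: path_nil.
    - case: tau E => //= a tau [Ec E]; have [a' st' /renE] := st.
      by rewrite -Ec => /f_inj Ea; subst a'; exact: weak_cons st' (IH _ E).
    - exact: (weak_cons (st : @trans _ M s0 None t) (IH _ E)).
  exact: back ws _ erefl.
have forth : forall s0 rho, weak (L := M) s0 rho s ->
    weak (L := lts_rename M [set x | x.2 = f x.1]) s0 (map f rho) s.
  apply: weak_ind => [|s0 [a|] t rho st IH].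
  - by exists [::] => //; exact: path_nil.
  - have st' : @trans _ (lts_rename M [set x | x.2 = f x.1]) s0 (Some (f a)) t.
      by exists a => //; exact/renE.
    exact: weak_cons st' IH.
  - exact: (weak_cons
      (st : @trans _ (lts_rename M [set x | x.2 = f x.1]) s0 None t) IH).
exact: forth ws.
Qed.

(** Hilbert's hotel: [f] moves [g n] to [g n.+1] along an injected copy of the naturals and fixes
    the rest, freeing [g 0]. This makes room for [b] even when an alphabet is all of [Act]. *)
Lemma infinite_shift : infinite_set [set: Act] ->
  exists (f : Act -> Act) b, injective f /\ forall a, f a <> b.
Proof.
move=> /infiniteP/card_leP[h].
pose g n := set_val (h (to_setT n)).
have g_inj : injective g.
  move=> m n /val_inj /(@inj _ _ _ h) E.
  by have [] := E (mem_set I) (mem_set I).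
pose f a :=
  if pselect (exists n, g n = a) is left e then g (sval (cid e)).+1 else a.
have fg n : f (g n) = g n.+1.
  rewrite /f; case: pselect => [e|[]]; last by exists n.
  by case: cid => m /= /g_inj ->.
have fN a : ~ (exists n, g n = a) -> f a = a.
  by rewrite /f; case: pselect.
exists f, (g 0); split=> [a c|a].
  have [[m <-]|Na] := pselect (exists n, g n = a);
  have [[n <-]|Nc] := pselect (exists n, g n = c).
  - by rewrite !fg => /g_inj[->].
  - by rewrite fg (fN c) // => E; case: Nc; exists m.+1.
  - by rewrite fg (fN a) // => E; case: Na; exists n.+1.
  - by rewrite !fN.
have [[n <-]|Na] := pselect (exists n, g n = a); first by rewrite fg => /g_inj.
by rewrite fN // => E; apply: Na; exists 0.
Qed.

End Probe.

(** * Collapse of a congruence that identifies [D] and [V] *)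

Section CongruenceCollapse.
Context {Act : Type} {R : LTS Act -> LTS Act -> Prop}.
Hypothesis R_congruence : congruence R.
Hypothesis CFFD_R : forall L L' : LTS Act, CFFD_equiv L L' -> R L L'.
Hypothesis R_D_V : R lts_D lts_V.

Let R_sym L L' : R L L' -> R L' L.
Proof. by case: (cong_equivalence R_congruence) => _ + _; exact. Qed.

Let R_trans L L' L'' : R L L' -> R L' L'' -> R L L''.
Proof. by case: (cong_equivalence R_congruence) => _ _ + ; exact. Qed.

Lemma R_par_V L : R L (lts_par L lts_V).
Proof.
apply: (R_trans (R_sym (CFFD_R (par_D_equiv L)))).
exact: cong_parr R_D_V.
Qed.

(** Both sides may be composed with [V]. Then no state is stable, so [Sf] is empty, and the two
    simulations equate [Div] and [Inf]. *)
Lemma R_simulated L L' :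
  alph L = alph L' -> simulated L L' -> simulated L' L -> R L L'.
Proof.
move=> eqA /simulated_par_V[DivLL' InfLL'] /simulated_par_V[DivL'L InfL'L].
apply: (R_trans (R_par_V L)); apply: R_trans (R_sym (R_par_V L')).
apply: CFFD_R; split; last 2 first.
- exact/seteqP.
- exact/seteqP.
- by rewrite /= eqA.
- by rewrite !Sf_par_V.
Qed.

Lemma R_run_stop (L1 L2 : LTS Act) sigma B :
    infinite_set [set: Act] -> alph L1 = alph L2 -> R L1 L2 ->
    Tr L1 sigma -> ~ Tr L2 sigma ->
  R (lts_run B) (lts_stop B).
Proof.
move=> /infinite_shift[f [b [f_inj fb]]] eqA R12 Tr1 nTr2.
pose Phi := [set x : Act * Act | x.2 = f x.1].
pose M1 := lts_rename L1 Phi; pose M2 := lts_rename L2 Phi.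
have RM : R M1 M2 := cong_rename R_congruence Phi R12.
have eqM : alph M1 = alph M2 by rewrite /= /rename_alph eqA.
have fresh_b : ~ alph M1 b.
  by move=> [a _ [/= /esym/fb//|[_ []]]]; exists (f a).
have TrM1 : Tr M1 (map f sigma) by apply/Tr_rename_inj.
have nTrM2 : ~ Tr M2 (map f sigma) by move/Tr_rename_inj => /(_ f_inj).
pose C := probe b (map f sigma) B.
have RC : R (C M1) (C M2).
  (* [probe] mentions the alphabet of its argument; only once the alphabets are identified are both
     sides in the same context. *)
  rewrite /C /probe eqM; apply: cong_hide => //; apply: cong_rename => //.
  by apply: cong_hide => //; exact: cong_parl.
have alphC1 : alph (C M1) = B by exact: probe_alph.
have alphC2 : alph (C M2) = B by apply: probe_alph; rewrite -eqM.
(* The chain is [lts_run B], [C M1], [C M2], [lts_stop B]. *)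
apply: (@R_trans _ (C M1)).
  apply: R_simulated => //; first exact: run_simulated_probe.
  by rewrite -[in lts_run _]alphC1; exact: simulated_run.
apply: (R_trans RC); apply: R_simulated => //; last exact: stop_simulated.
exact: probe_simulated_stop.
Qed.

Lemma R_stop (L : LTS Act) :
  R (lts_run (alph L)) (lts_stop (alph L)) -> R L (lts_stop (alph L)).
Proof.
move=> Rrs; apply: (@R_trans _ (lts_par L (lts_run (alph L)))).
  apply: R_simulated; first by rewrite /= setUid.
    exact: simulated_par_run.
  exact: par_run_simulated.
apply: (R_trans (cong_parr R_congruence L Rrs)).
apply: R_simulated; first by rewrite /= setUid.
  exact: par_stop_simulated.
exact: stop_simulated.
Qed.

End CongruenceCollapse.

Theorem theorem4p6 (Act : Type) (infinite_Act : infinite_set [set: Act])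
    (R : LTS Act -> LTS Act -> Prop)
    (R_congruence : congruence R)
    (CFFD_R : forall L L' : LTS Act, CFFD_equiv L L' -> R L L')
    (R_alph : preserves R (@alph Act))
    (R_Tr : ~ preserves R (@Tr Act))
    (R_D_V : R lts_D lts_V) :
  forall L L' : LTS Act, R L L' <-> alph L = alph L'.
Proof.
have [_ R_sym R_trans] := cong_equivalence R_congruence.
have [L1 [L2 [sigma [R12 Tr1 nTr2]]]] :
    exists L1 L2 sigma, [/\ R L1 L2, Tr L1 sigma & ~ Tr L2 sigma].
  (* The distinguishing trace may lie on either side; symmetry of [R] lets its owner be called
     [L1]. *)
  apply: contrapT => none; apply: R_Tr => L1 L2 R12; apply/seteqP.
  by split=> sigma Tr1; apply: contrapT => nTr2; apply: none;
    [exists L1, L2|exists L2, L1]; exists sigma; split=> //; exact: R_sym.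
have RL_stop L : R L (lts_stop (alph L)).
  apply: R_stop => //; exact: R_run_stop (R_alph _ _ R12) R12 Tr1 nTr2.
move=> L L'; split=> [/R_alph//|eqA].
apply: (R_trans _ (lts_stop (alph L))) => //; apply: R_sym; rewrite eqA.
exact: RL_stop.
Qed.
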